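(* Let $\mathcal{M}$ be a unitary magma. The set $\mathcal{P}_{\mathcal{M}}$ of all prime $\mathcal{M}$-cliques is a minimal generating set of the operad $\mathsf{C}\mathcal{M}$.
   Context: All vector spaces are over a field $\mathbb{K}$ of characteristic zero; $[n]=\{1,\dots,n\}$. Operad means nonsymmetric operad in vector spaces, graded by arities $n\ge1$, with partial compositions $\circ_i$ and a unit in arity $1$. A subset $G$ of an operad $\mathcal{O}$ is a minimal generating set if the smallest suboperad of $\mathcal{O}$ containing $G$ is $\mathcal{O}$, and $G$ is minimal for inclusion among the subsets of $G$ with this property. A unitary magma is a set $\mathcal{M}$ with a binary operation $\star$ (not necessarily associative) having a two-sided unit $\mathds{1}_{\mathcal{M}}$. An $\mathcal{M}$-clique $\mathfrak{p}$ of arity $n\ge1$ is a map assigning to every arc $(x,y)$, $1\le x<y\le n+1$, a label $\mathfrak{p}(x,y)\in\mathcal{M}$; by convention, the only $\mathcal{M}$-clique of arity $1$ is the one with $\mathfrak{p}(1,2)=\mathds{1}_{\mathcal{M}}$. Put $\mathfrak{p}_0:=\mathfrak{p}(1,n+1)$ and $\mathfrak{p}_i:=\mathfrak{p}(i,i+1)$ for $i\in[n]$. $\mathsf{C}\mathcal{M}$ is the operad whose space $\mathsf{C}\mathcal{M}(n)$ is the linear span of all $\mathcal{M}$-cliques of arity $n$, whose unit is the unique $\mathcal{M}$-clique of arity $1$, and where, for $\mathcal{M}$-cliques $\mathfrak{p},\mathfrak{q}$ of arities $n,m$ and $i\in[n]$, $\mathfrak{p}\circ_i\mathfrak{q}$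 is the $\mathcal{M}$-clique of arity $n+m-1$ with $$(\mathfrak{p}\circ_i\mathfrak{q})(x,y)=\begin{cases}\mathfrak{p}(x,y)&\text{if }y\le i,\\ \mathfrak{p}(x,y-m+1)&\text{if }x\le i<i+m\le y,\ (x,y)\ne(i,i+m),\\ \mathfrak{p}(x-m+1,y-m+1)&\text{if }i+m\le x,\\ \mathfrak{q}(x-i+1,y-i+1)&\text{if }i\le x<y\le i+m,\ (x,y)\ne(i,i+m),\\ \mathfrak{p}_i\star\mathfrak{q}_0&\text{if }(x,y)=(i,i+m),\\ \mathds{1}_{\mathcal{M}}&\text{otherwise.}\end{cases}$$ A diagonal of an $\mathcal{M}$-clique of arity $n$ is an arc different from $(1,n+1)$ and from all $(x,x+1)$. An arc is solid if its label is not $\mathds{1}_{\mathcal{M}}$. Two diagonals $(x,y)$ and $(x',y')$ are crossing if $x<x'<y<y'$ or $x'<x<y'<y$. An $\mathcal{M}$-clique $\mathfrak{p}$ of arity $n\ge2$ is prime if for every (not necessarily solid) diagonal $(x,y)$ of $\mathfrak{p}$ there is at least one solid diagonal $(x',y')$ of $\mathfrak{p}$ such that $(x,y)$ and $(x',y')$ are crossing. (In particular all $\mathcal{M}$-cliques of arity $2$ are prime.) *)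

(* Defs.v *)
(* MathComp, with the free modules {malg K[T]} of multinomials. *)
From HB Require Import structures.
From mathcomp Require Import all_boot all_order all_algebra.
From mathcomp Require Import finmap zify.
From mathcomp.multinomials Require Import monalg.

Set Implicit Arguments.
Unset Strict Implicit.
Unset Printing Implicit Defensive.

Import GRing.Theory.
Local Open Scope ring_scope.

(* Conventions.  Arities are positive, so the component indexed by k : nat is
   the one of arity k.+1: composing arities n.+1 and m.+1 gives arity
   (n + m).+1.  Inputs and vertices are numbered from 0: the inputs of an
   element of arity k.+1 are 0, ..., k and the vertices of a clique of arity
   k.+1 are 0, ..., k.+1 instead of 1, ..., k.+2. *)

Section Operads.

Variable K : fieldType.

Definition cast_op (O : nat -> lmodType K) m n (e : m = n) (x : O m) : O n :=
  ecast i (O i) e x.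

(* Nonsymmetric operads.  As inputs are numbered from 0, the 1-based index
   i + j - 1 of the sequential axiom becomes i + j, while the index
   j + (m.+1) - 1 of the parallel axiom becomes j + m. *)
Record operad := Operad {
  op_space :> nat -> lmodType K;
  op_unit : op_space 0;
  op_comp : forall n m, 'I_n.+1 -> op_space n -> op_space m -> op_space (n + m);
  op_comp_linear_l : forall n m (i : 'I_n.+1) (y : op_space m),
    linear (fun x : op_space n => op_comp i x y);
  op_comp_linear_r : forall n m (i : 'I_n.+1) (x : op_space n),
    linear (fun y : op_space m => op_comp i x y);
  op_unit_l : forall n (x : op_space n), op_comp ord0 op_unit x = x;
  op_unit_r : forall n (i : 'I_n.+1) (x : op_space n),
    cast_op (addn0 n) (op_comp i x op_unit) = x;
  op_comp_seq : forall n m l (i : 'I_n.+1) (j : 'I_m.+1) (k : 'I_(n + m).+1)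
      (x : op_space n) (y : op_space m) (z : op_space l),
    k = (i + j)%N :> nat ->
    cast_op (addnA n m l) (op_comp i x (op_comp j y z)) =
      op_comp k (op_comp i x y) z;
  op_comp_par : forall n m l (i j : 'I_n.+1)
      (i' : 'I_(n + l).+1) (j' : 'I_(n + m).+1)
      (x : op_space n) (y : op_space m) (z : op_space l),
    (i < j)%N -> i' = i :> nat -> j' = (j + m)%N :> nat ->
    cast_op (addnAC n m l) (op_comp j' (op_comp i x y) z) =
      op_comp i' (op_comp j x z) y
}.

Definition op_subset (O : operad) := forall k, O k -> Prop.

Definition op_incl (O : operad) (G H : op_subset O) :=
  forall k (x : O k), G k x -> H k x.

Record suboperad (O : operad) (S : op_subset O) : Prop := Suboperad {
  suboperad_unit : S 0%N (op_unit O);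
  suboperad_zero : forall k, S k 0;
  suboperad_linear : forall k (c : K) (x y : O k),
    S k x -> S k y -> S k (c *: x + y);
  suboperad_comp : forall n m (i : 'I_n.+1) (x : O n) (y : O m),
    S n x -> S m y -> S (n + m)%N (op_comp i x y)
}.

(* The smallest suboperad containing G. *)
Definition generated (O : operad) (G : op_subset O) : op_subset O :=
  fun k x => forall S : op_subset O, suboperad S -> op_incl G S -> S k x.

Definition generating (O : operad) (G : op_subset O) :=
  forall k (x : O k), generated G x.

Definition minimal_generating (O : operad) (G : op_subset O) :=
  generating G /\
  forall H : op_subset O, op_incl H G -> generating H -> op_incl G H.

End Operads.

Section LinearExtension.

Variables (K : fieldType) (T : choiceType).

Definition lin_ext (V : lmodType K) (h : T -> V) (u : {malg K[T]}) : V :=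
  \sum_(t <- msupp u) u@_t *: h t.

Lemma lin_extEw (V : lmodType K) (h : T -> V) (d : {fset T}) u :
  (msupp u `<=` d)%fset -> lin_ext h u = \sum_(t <- d) u@_t *: h t.
Proof.
move=> ud; rewrite /lin_ext [LHS](big_fset_incl _ ud) //.
by move=> t _ /mcoeff_outdom ->; rewrite scale0r.
Qed.

Lemma lin_ext_linear (V : lmodType K) (h : T -> V) : linear (lin_ext h).
Proof.
move=> c u v; pose d := (msupp (c *: u + v) `|` (msupp u `|` msupp v))%fset.
rewrite !(@lin_extEw _ h d) /d ?fsubsetUl //.
- rewrite scaler_sumr -big_split; apply: eq_bigr => t _ /=.
  by rewrite mcoeffD mcoeffZ scalerDl scalerA.
- by rewrite fsubsetU // fsubsetUr orbT.
- by rewrite fsubsetU // fsubsetUl orbT.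
Qed.

Lemma lin_extU (V : lmodType K) (h : T -> V) t : lin_ext h << t >> = h t.
Proof.
by rewrite /lin_ext msuppU oner_eq0 big_seq_fset1 mcoeffUU scale1r.
Qed.

Lemma eq_lin_ext (V : lmodType K) (h1 h2 : T -> V) u :
  h1 =1 h2 -> lin_ext h1 u = lin_ext h2 u.
Proof. by move=> h12; apply: eq_bigr => t _; rewrite h12. Qed.

Lemma lin_ext_hlinear (V : lmodType K) (h1 h2 : T -> V) c u :
  lin_ext (fun t => c *: h1 t + h2 t) u = c *: lin_ext h1 u + lin_ext h2 u.
Proof.
rewrite /lin_ext scaler_sumr -big_split; apply: eq_bigr => t _ /=.
by rewrite scalerDr !scalerA mulrC.
Qed.

Lemma linear_malgP (V : lmodType K) (f g : {malg K[T]} -> V) :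
  linear f -> linear g -> (forall t, f << t >> = g << t >>) -> f =1 g.
Proof.
move=> fL gL fg u.
have lin0 (f' : {malg K[T]} -> V) : linear f' -> f' 0 = 0.
  move=> /(_ (-1) 0 0); rewrite scaleN1r addNr => ->.
  by rewrite scaleN1r addNr.
rewrite (monalgE u); elim/big_rec: _ => [|t v _ IH]; first by rewrite !lin0.
have -> : << u@_t *g t >> = u@_t *: << t >> :> {malg K[T]}.
  by apply/malgP => s; rewrite mcoeffZ !mcoeffU mulr_natr.
by rewrite fL gL fg IH.
Qed.

End LinearExtension.

Section Cliques.

Variable M : umagmaType.

Definition arc k := {a : 'I_k.+2 * 'I_k.+2 | a.1 < a.2}%N.

(* In arity 1 (k = 0), the only clique is the one whose arc is labelled 1. *)
Definition clique_axiom k (l : {ffun arc k -> M}) : bool :=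
  (k == 0%N) ==> [forall a, l a == 1%g].

Record clique k := Clique {
  labels :> {ffun arc k -> M};
  _ : clique_axiom labels
}.

HB.instance Definition _ k := [isSub for @labels k].
HB.instance Definition _ k := [Choice of clique k by <:].

(* The label of the arc (x, y), where x < y <= k.+1 (other values of x and y
   are irrelevant). *)
Definition label k (p : clique k) (x y : nat) : M :=
  oapp p 1%g (insub (inord x, inord y)).

(* The labels of the composite at input i of two cliques with labels f and g,
   the second one having arity m.+1.  Testing the glued arc (i, i + m.+1) first
   excludes it from the other cases; with vertices numbered from 0, the shift
   x - i + 1 in g becomes x - i. *)
Definition comp_label (m i : nat) (f g : nat -> nat -> M) (x y : nat) : M :=
  if (x == i) && (y == i + m.+1)%N then (f i i.+1 * g 0%N m.+1)%g
  else if (y <= i)%N then f x y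
  else if (x <= i)%N && (i + m.+1 <= y)%N then f x (y - m)%N
  else if (i + m.+1 <= x)%N then f (x - m)%N (y - m)%N
  else if (i <= x)%N && (y <= i + m.+1)%N then g (x - i)%N (y - i)%N
  else 1%g.

Definition mklabels k (f : nat -> nat -> M) : {ffun arc k -> M} :=
  [ffun a : arc k => f (val a).1 (val a).2].

Lemma label0 (p : clique 0) x y : label p x y = 1%g.
Proof.
rewrite /label; case: insubP => //= a _ _.
by case: p => l /= /forallP /(_ a) /eqP.
Qed.

Lemma clique_unit_subproof : clique_axiom (mklabels 0 (fun _ _ => 1%g)).
Proof. by apply/implyP => _; apply/forallP => a; rewrite ffunE. Qed.

Definition clique_unit : clique 0 := Clique clique_unit_subproof.

Lemma clique_comp_subproof n m (i : 'I_n.+1) (p : clique n) (q : clique m) :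
  clique_axiom (mklabels (n + m) (comp_label m i (label p) (label q))).
Proof.
apply/implyP; rewrite addn_eq0 => /andP[/eqP n0 /eqP m0]; subst n m.
apply/forallP => a; rewrite ffunE /comp_label !label0 mulg1.
by rewrite !if_same.
Qed.

Definition clique_comp n m (i : 'I_n.+1) (p : clique n) (q : clique m) :
  clique (n + m) := Clique (clique_comp_subproof i p q).

Definition diagonal k (a : arc k) : bool :=
  let: (x, y) := val a in
  ~~ ((x == 0 :> nat) && (y == k.+1 :> nat)) && (y != x.+1 :> nat).

Definition solid k (p : clique k) (a : arc k) : bool := p a != 1%g.

Definition crossing k (a b : arc k) : bool :=
  let: (x, y) := val a in
  let: (x', y') := val b in
  [&& x < x', x' < y & y < y']%N || [&& x' < x, x < y' & y' < y]%N.

Definition prime_clique k (p : clique k) : bool :=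
  (2 <= k.+1)%N &&
  [forall a : arc k, diagonal a ==>
    [exists b : arc k, [&& diagonal b, solid p b & crossing a b]]].

Lemma label_mk k f (H : clique_axiom (mklabels k f)) x y :
  (x < y <= k.+1)%N -> label (Clique H) x y = f x y.
Proof.
move=> /andP[xy yk]; have xk : (x < k.+2)%N by lia.
rewrite /label; case: insubP => [a _ ae|]; last by rewrite /= !inordK ?xy.
by rewrite /= ffunE ae /= !inordK.
Qed.

Lemma label_inj k (p q : clique k) :
  (forall x y, (x < y <= k.+1)%N -> label p x y = label q x y) -> p = q.
Proof.
move=> pq; apply/val_inj/ffunP => a.
have lab (r : clique k) : label r (val a).1 (val a).2 = r a.
  by rewrite /label !inord_val -surjective_pairing valK.
have H := pq (val a).1 (val a).2; rewrite !lab in H; apply: H.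
by rewrite (valP a) -ltnS ltn_ord.
Qed.

Lemma comp_label_ext (n m i : nat) (f f' g g' : nat -> nat -> M) x y :
    (i <= n)%N -> (x < y <= (n + m).+1)%N ->
    (forall a b, (a < b <= n.+1)%N -> f a b = f' a b) ->
    (forall a b, (a < b <= m.+1)%N -> g a b = g' a b) ->
  comp_label m i f g x y = comp_label m i f' g' x y.
Proof.
move=> ? ? ff gg; rewrite /comp_label.
by do ![case: ifP => ?]; rewrite ?ff ?gg //; lia.
Qed.

Ltac case_test b :=
  match b with
  | ?c && _ => case_test c
  | (?u <= ?v)%N => case: (leqP u v) => ? /=
  | ?u == ?v => case: (ltngtP u v) => ? /=
  end.

Ltac label_cases :=
  rewrite /comp_label;
  repeat (match goal with |- context [if ?b then _ else _] => case_test b end;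
          try (exfalso; lia));
  try reflexivity; try (f_equal; lia); try (f_equal; f_equal; lia).

Lemma comp_label_seq (m l i j : nat) (f g h : nat -> nat -> M) (x y : nat) :
  (m = 0%N -> forall a b, g a b = 1%g) -> (j <= m)%N -> (x < y)%N ->
  comp_label (m + l) i f (comp_label l j g h) x y =
  comp_label l (i + j) (comp_label m i f g) h x y.
Proof.
move=> g1 ? ?; label_cases.
by have m0 : m = 0%N by [lia]; rewrite !g1 // mul1g mulg1.
Qed.

Lemma comp_label_par (m l i j : nat) (f g h : nat -> nat -> M) (x y : nat) :
  (i < j)%N -> (x < y)%N ->
  comp_label l (j + m) (comp_label m i f g) h x y =
  comp_label m i (comp_label l j f h) g x y.
Proof. by move=> ? ?; label_cases. Qed.

Lemma label_comp n m (i : 'I_n.+1) (p : clique n) (q : clique m) x y :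
  (x < y <= (n + m).+1)%N ->
  label (clique_comp i p q) x y = comp_label m i (label p) (label q) x y.
Proof. exact: label_mk. Qed.

Definition cast_clique k k' (e : k = k') (p : clique k) : clique k' :=
  ecast i (clique i) e p.

Lemma label_cast k k' (e : k = k') (p : clique k) :
  label (cast_clique e p) =2 label p.
Proof. by case: k' / e. Qed.

Lemma clique_unit_l n (p : clique n) : clique_comp ord0 clique_unit p = p.
Proof.
apply: label_inj => x y xy; rewrite label_comp // /comp_label !label0 mul1g /=.
rewrite !add0n !subn0.
have [/andP[/eqP -> /eqP ->] //|] := boolP ((x == 0%N) && (y == n.+1)).
by move=> ?; do ![case: ifP => ?] => //; lia.
Qed.

Lemma clique_unit_r n (i : 'I_n.+1) (p : clique n) :
  cast_clique (addn0 n) (clique_comp i p clique_unit) = p.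
Proof.
apply: label_inj => x y xy; rewrite label_cast label_comp; last by lia.
by rewrite /comp_label !label0 mulg1 !subn0; label_cases.
Qed.

Lemma clique_comp_seq n m l (i : 'I_n.+1) (j : 'I_m.+1) (k : 'I_(n + m).+1)
    (p : clique n) (q : clique m) (r : clique l) :
  k = (i + j)%N :> nat ->
  cast_clique (addnA n m l) (clique_comp i p (clique_comp j q r)) =
    clique_comp k (clique_comp i p q) r.
Proof.
have := ltn_ord i; have := ltn_ord j => jm im kE.
apply: label_inj => x y xy; rewrite label_cast !label_comp; try lia.
rewrite (comp_label_ext (n := n) (m := m + l) (f := label p) (f' := label p)
  (g' := comp_label l j (label q) (label r))) //; try lia; last first.
  by move=> a b ab; rewrite label_comp.
rewrite (comp_label_ext (n := n + m) (m := l) (g := label r) (g' := label r)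
  (f' := comp_label m i (label p) (label q))) //; try lia; last first.
  by move=> a b ab; rewrite label_comp.
rewrite kE comp_label_seq //; try lia.
by move=> m0 a b; move: q; rewrite m0 => q; rewrite label0.
Qed.

Lemma clique_comp_par n m l (i j : 'I_n.+1)
    (i' : 'I_(n + l).+1) (j' : 'I_(n + m).+1)
    (p : clique n) (q : clique m) (r : clique l) :
  (i < j)%N -> i' = i :> nat -> j' = (j + m)%N :> nat ->
  cast_clique (addnAC n m l) (clique_comp j' (clique_comp i p q) r) =
    clique_comp i' (clique_comp j p r) q.
Proof.
have := ltn_ord i; have := ltn_ord j => jn im ij i'E j'E.
apply: label_inj => x y xy; rewrite label_cast !label_comp; try lia.
rewrite (comp_label_ext (n := n + m) (m := l) (g := label r) (g' := label r)
  (f' := comp_label m i (label p) (label q))) //; try lia; last first.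
  by move=> a b ab; rewrite label_comp.
rewrite (comp_label_ext (n := n + l) (m := m) (g := label q) (g' := label q)
  (f' := comp_label l j (label p) (label r))) //; try lia; last first.
  by move=> a b ab; rewrite label_comp.
by rewrite i'E j'E comp_label_par //; lia.
Qed.

End Cliques.

Section CliqueOperad.

Variables (K : fieldType) (M : umagmaType).

Definition clique_space (k : nat) : lmodType K := {malg K[clique M k]}.

Definition clique_op_comp n m (i : 'I_n.+1)
    (u : clique_space n) (v : clique_space m) : clique_space (n + m) :=
  lin_ext (fun p => lin_ext (fun q => << clique_comp i p q >>) v) u.

Lemma clique_op_compU n m (i : 'I_n.+1) (p : clique M n) (q : clique M m) :
  clique_op_comp i << p >> << q >> = << clique_comp i p q >>.
Proof. by rewrite /clique_op_comp !lin_extU. Qed.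

Lemma clique_op_comp_linear_l n m (i : 'I_n.+1) (v : clique_space m) :
  linear (fun u : clique_space n => clique_op_comp i u v).
Proof. exact: lin_ext_linear. Qed.

Lemma clique_op_comp_linear_r n m (i : 'I_n.+1) (u : clique_space n) :
  linear (fun v : clique_space m => clique_op_comp i u v).
Proof.
move=> c v w; rewrite /clique_op_comp -lin_ext_hlinear.
by apply: eq_lin_ext => p; rewrite lin_ext_linear.
Qed.

Lemma cast_op_linear k k' (e : k = k') :
  linear (fun u : clique_space k => cast_op e u).
Proof. by case: k' / e. Qed.

Lemma cast_opU k k' (e : k = k') (p : clique M k) :
  @cast_op K clique_space k k' e << p >> = << cast_clique e p >>.
Proof. by case: k' / e. Qed.

Lemma linear_compose (U V W : lmodType K) (f : V -> W) (g : U -> V) :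
  linear f -> linear g -> linear (fun x => f (g x)).
Proof. by move=> fL gL c x y; rewrite gL fL. Qed.

Lemma clique_op_unit_l n (u : clique_space n) :
  clique_op_comp ord0 << clique_unit M >> u = u.
Proof.
move: u; apply: linear_malgP => //; first exact: clique_op_comp_linear_r.
by move=> p; rewrite clique_op_compU clique_unit_l.
Qed.

Lemma clique_op_unit_r n (i : 'I_n.+1) (u : clique_space n) :
  cast_op (addn0 n) (clique_op_comp i u << clique_unit M >>) = u.
Proof.
move: u; apply: linear_malgP => //.
  apply: linear_compose; first exact: cast_op_linear.
  exact: clique_op_comp_linear_l.
by move=> p; rewrite clique_op_compU cast_opU clique_unit_r.
Qed.

Ltac solve_linear :=
  repeat first [ exact: clique_op_comp_linear_l
               | exact: clique_op_comp_linear_r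
               | exact: cast_op_linear
               | apply: (linear_compose (cast_op_linear _))
               | apply: (linear_compose (clique_op_comp_linear_l _ _))
               | apply: (linear_compose (clique_op_comp_linear_r _ _)) ].

Lemma clique_op_comp_seq n m l (i : 'I_n.+1) (j : 'I_m.+1) (k : 'I_(n + m).+1)
    (u : clique_space n) (v : clique_space m) (w : clique_space l) :
  k = (i + j)%N :> nat ->
  cast_op (addnA n m l) (clique_op_comp i u (clique_op_comp j v w)) =
    clique_op_comp k (clique_op_comp i u v) w.
Proof.
move=> kE.
move: u; apply: linear_malgP; [by solve_linear | by solve_linear | move=> p].
move: v; apply: linear_malgP; [by solve_linear | by solve_linear | move=> q].
move: w; apply: linear_malgP; [by solve_linear | by solve_linear | move=> r].
by rewrite !clique_op_compU cast_opU (clique_comp_seq _ _ _ kE).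
Qed.

Lemma clique_op_comp_par n m l (i j : 'I_n.+1)
    (i' : 'I_(n + l).+1) (j' : 'I_(n + m).+1)
    (u : clique_space n) (v : clique_space m) (w : clique_space l) :
  (i < j)%N -> i' = i :> nat -> j' = (j + m)%N :> nat ->
  cast_op (addnAC n m l) (clique_op_comp j' (clique_op_comp i u v) w) =
    clique_op_comp i' (clique_op_comp j u w) v.
Proof.
move=> ij i'E j'E.
move: u; apply: linear_malgP; [by solve_linear | by solve_linear | move=> p].
move: v; apply: linear_malgP; [by solve_linear | by solve_linear | move=> q].
move: w; apply: linear_malgP; [by solve_linear | by solve_linear | move=> r].
by rewrite !clique_op_compU cast_opU (clique_comp_par _ _ _ ij i'E j'E).
Qed.

Definition clique_operad : operad K :=
  @Operad K clique_space << clique_unit M >> clique_op_comp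
    clique_op_comp_linear_l clique_op_comp_linear_r
    clique_op_unit_l clique_op_unit_r clique_op_comp_seq clique_op_comp_par.

Definition prime_cliques : op_subset clique_operad :=
  fun k x => exists2 p : clique M k, prime_clique p & x = << p >>.

End CliqueOperad.

Arguments prime_cliques : clear implicits.

(* Main.v *)
From mathcomp Require Import all_boot all_order all_algebra.
From mathcomp Require Import finmap zify.
From mathcomp.multinomials Require Import monalg.
Require Import Defs.

(** Call an arc of a clique uncrossed when no solid arc crosses it.  Cutting a
    clique along an uncrossed diagonal (x, y) displays it as a composite of two
    smaller cliques: the part between x and y, whose base is given the label 1,
    is grafted on the rest of the clique, where (x, y) has become an edge that
    keeps its label; since 1 is a right unit of the magma, the glued arc
    recovers that label.  By induction on the arity, every clique other
    than the unit is thus a composite of cliques without uncrossed diagonal,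
    that is, of prime cliques, and these generate ([generated_clique]).

    Conversely, in a composite of two cliques of arity at least 2, the glued arc
    is an uncrossed diagonal, so the composite is not prime
    ([clique_comp_not_prime]).  A composite of two elements can therefore have
    a nonzero coefficient on a prime clique only when one of them has arity 1,
    and it is then a scalar multiple of the other.  Hence, for any set H, the
    elements whose prime terms all lie in H form a suboperad
    ([prime_terms_suboperad]).  If H consists of prime cliques and generates,
    that suboperad is everything, and each prime clique, being its own only
    term, belongs to H. *)

Set Implicit Arguments.
Unset Strict Implicit.
Unset Printing Implicit Defensive.

Import GRing.Theory.
Local Open Scope ring_scope.

Section Cutting.

Variable M : umagmaType.

Lemma label_arc k (p : clique M k) (a : arc k) :
  label p (val a).1 (val a).2 = p a.
Proof. by rewrite /label !inord_val -surjective_pairing valK. Qed.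

Lemma arc_of_nat k x y : (x < y <= k.+1)%N ->
  exists a : arc k, (val a).1 = x :> nat /\ (val a).2 = y :> nat.
Proof.
move=> /andP[xy yk]; have xk : (x < k.+2)%N by lia.
by exists (exist (fun a : 'I_k.+2 * 'I_k.+2 => (a.1 < a.2)%N)
  (Ordinal xk, Ordinal (yk : (y < k.+2)%N)) xy).
Qed.

Definition uncrossed k (p : clique M k) (x y : nat) : Prop :=
  forall u v, (u < v <= k.+1)%N ->
    [&& x < u, u < y & y < v]%N || [&& u < x, x < v & v < y]%N ->
  label p u v = 1%g.

(** Turns primality into a statement on natural numbers.  An arc crossing
    another one is automatically a diagonal, so quantifying over all crossing
    arcs in [uncrossed] agrees with quantifying over diagonals. *)
Lemma not_primeP k (p : clique M k) : (0 < k)%N ->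
  reflect (exists x y, [/\ (x.+1 < y <= k.+1)%N, (y - x <= k)%N
                         & uncrossed p x y])
          (~~ prime_clique p).
Proof.
move=> k0; rewrite /prime_clique ltnS k0 /= negb_forall.
apply: (iffP existsP) => [[a]|[x [y [xy yxk unc]]]].
  rewrite negb_imply negb_exists => /andP[da /forallP nocross].
  exists (val a).1, (val a).2.
  have altn : ((val a).1 < (val a).2)%N := valP a.
  have a2 := ltn_ord (val a).2.
  have da' : ~~ (((val a).1 == 0 :> nat) && ((val a).2 == k.+1 :> nat)) &&
             ((val a).2 != (val a).1.+1 :> nat).
    by move: da; rewrite /diagonal; case: (val a).
  split; [lia | lia | move=> u v uv cr].
  have [b [bu bv]] := arc_of_nat uv.
  have cab : crossing a b.
    by rewrite /crossing; case: (val a) (val b) bu bv cr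
      => [a1 a2'] [b1 b2] /= <- <-.
  have db : diagonal b.
    rewrite /diagonal; case: (val b) bu bv => b1 b2 /= -> ->; lia.
  have := nocross b; rewrite db cab andbT /= negbK => /eqP.
  by rewrite -label_arc bu bv.
have [|a [ax ay]] := @arc_of_nat k x y; first by lia.
exists a; rewrite negb_imply negb_exists.
have -> : diagonal a.
  rewrite /diagonal; case: (val a) ax ay => a1 a2 /= -> ->; lia.
apply/forallP => b; apply/negP => /and3P[_ sb cab].
move/negP: sb; apply; apply/eqP; rewrite -label_arc; apply: unc.
  by rewrite (valP b) -ltnS ltn_ord.
by move: cab; rewrite /crossing; case: (val a) (val b) ax ay
  => [a1 a2] [b1 b2] /= -> ->.
Qed.

(** The glued arc (i, i + m + 1) is the uncrossed diagonal: an arc from a vertex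
    strictly inside the grafted clique to one outside it is labelled 1. *)
Lemma clique_comp_not_prime n m (i : 'I_n.+1) (p : clique M n)
    (q : clique M m) :
  (0 < n)%N -> (0 < m)%N -> ~~ prime_clique (clique_comp i p q).
Proof.
have := ltn_ord i => lti n0 m0; apply/not_primeP; first by lia.
exists (i : nat), (i + m.+1)%N; split; [lia | lia | move=> u v uv cr].
rewrite label_comp // /comp_label.
by do ![case: ifP => ?] => //; lia.
Qed.

Lemma mk_clique k (f : nat -> nat -> M) : (0 < k)%N ->
  exists p : clique M k, forall x y, (x < y <= k.+1)%N -> label p x y = f x y.
Proof.
move=> k0; have ax : clique_axiom (mklabels k f).
  by rewrite /clique_axiom eqn0Ngt k0.
by exists (Clique ax) => x y; apply: label_mk.
Qed.

(** A clique is cut along an uncrossed diagonal (x, y): the vertices strictly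
    between x and y are deleted in [q], and only the vertices from x to y are
    kept in [r].  The only labels that [q] and [r] forget are those of the arcs
    from a deleted vertex of [q] to a vertex outside [r]; these arcs cross
    (x, y), so their labels are 1, as in the composite. *)
Lemma not_prime_decomp k (p : clique M k) : (0 < k)%N -> ~~ prime_clique p ->
  exists n m (e : (n + m)%N = k) (i : 'I_n.+1) (q : clique M n)
         (r : clique M m),
    [/\ (0 < n)%N, (0 < m)%N & p = cast_clique e (clique_comp i q r)].
Proof.
move=> k0 /(not_primeP _ k0)[x [y [xy yxk unc]]].
pose m := (y - x).-1; pose n := (k - m)%N.
have e : (n + m)%N = k by rewrite /n /m; lia.
have lti : (x < n.+1)%N by rewrite /n /m; lia.
have n0 : (0 < n)%N by rewrite /n /m; lia.
have m0 : (0 < m)%N by rewrite /m; lia.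
have yE : y = (x + m.+1)%N by rewrite /m; lia.
(* [sh] sends the vertices of [q] to those of [p]. *)
pose sh u := if (u <= x)%N then u else (u + m)%N.
have [q qE] := mk_clique (fun u v => label p (sh u) (sh v)) n0.
have [r rE] := mk_clique (fun u v =>
  if (u == 0%N) && (v == m.+1) then 1%g else label p (u + x)%N (v + x)%N) m0.
exists n, m, e, (Ordinal lti), q, r; split=> //.
apply: label_inj => u v uv; rewrite label_cast label_comp; last by lia.
rewrite /comp_label /=.
case: ifP => [/andP[/eqP -> /eqP ->]|uvx].
  rewrite qE; last by lia.
  rewrite rE; last by lia.
  rewrite !eqxx /= mulg1 /sh leqnn ltnn.
  by congr label; lia.
case: ifP => vx.
  by rewrite qE; [rewrite /sh vx ifT //; lia | lia].
case: ifP => uvx2.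
  rewrite qE; last by lia.
  rewrite /sh; case: ifP => ?; last by lia.
  by rewrite ifF; [congr label; lia | lia].
case: ifP => ux2.
  by rewrite qE; [rewrite /sh !ifF; [congr label; lia | lia | lia] | lia].
case: ifP => uvx3.
  by rewrite rE; [rewrite ifF; [congr label; lia | lia] | lia].
by rewrite unc //; lia.
Qed.

Lemma clique0_unique (p : clique M 0) : p = clique_unit M.
Proof. by apply: label_inj => x y _; rewrite !label0. Qed.

End Cutting.

Section Generation.

Variables (K : fieldType) (M : umagmaType).

Lemma op_subset_cast (O : operad K) (S : op_subset O) k k' (e : k = k')
    (x : O k) : S k' (cast_op e x) <-> S k x.
Proof. by case: k' / e. Qed.

Lemma generated_clique (S : op_subset (clique_operad K M)) k
    (p : clique M k) :
  suboperad S -> op_incl (prime_cliques K M) S -> S k << p >>.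
Proof.
move=> subS primeS; elim/ltn_ind: k p => -[_ p|k IH p].
  by rewrite (clique0_unique p); apply: (suboperad_unit subS).
have [pp|npp] := boolP (prime_clique p); first by apply: primeS; exists p.
have [n [m [e [i [q [r [n0 m0 ->]]]]]]] := not_prime_decomp (ltn0Sn k) npp.
rewrite -(@cast_opU K); apply/(op_subset_cast S e).
rewrite -clique_op_compU; apply: (suboperad_comp subS); apply: IH; lia.
Qed.

Lemma malg_sum_scale (T : choiceType) (u : {malg K[T]}) :
  u = \sum_(t <- msupp u) u@_t *: << t >>.
Proof.
rewrite {1}[u]monalgE; apply: eq_bigr => t _.
by apply/malgP => s; rewrite mcoeffZ !mcoeffU mulr_natr.
Qed.

Lemma prime_cliques_generate :
  @generating K (clique_operad K M) (prime_cliques K M).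
Proof.
move=> k u S subS primeS.
rewrite [u]malg_sum_scale; elim/big_rec: _ => [|p v _ Sv].
  exact: (suboperad_zero subS).
by apply: (suboperad_linear subS) => //; apply: generated_clique.
Qed.

(** By bilinearity this reduces to two cliques, whose composite is not prime. *)
Lemma mcoeff_comp_prime n m (i : 'I_n.+1) (u : clique_space K M n)
    (v : clique_space K M m) (p : clique M (n + m)) :
  (0 < n)%N -> (0 < m)%N -> prime_clique p -> (clique_op_comp i u v)@_p = 0.
Proof.
move=> n0 m0 pp.
have zeroL (V : lmodType K) : linear (fun _ : V => 0 : K^o).
  by move=> c x y; rewrite scaler0 addr0.
have coefL : linear (fun w : {malg K[clique M (n + m)]} => w@_p : K^o).
  by move=> c x y; rewrite mcoeffD mcoeffZ.
move: u; apply: (@linear_malgP _ _ K^o); [| exact: zeroL | move=> q].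
  by move=> c x y; rewrite clique_op_comp_linear_l coefL.
move: v; apply: (@linear_malgP _ _ K^o); [| exact: zeroL | move=> r].
  by move=> c x y; rewrite clique_op_comp_linear_r coefL.
rewrite clique_op_compU mcoeffU; case: eqP => // qr.
by move: pp; rewrite -qr (negPf (clique_comp_not_prime _ _ _ n0 m0)).
Qed.

Lemma clique_space0 (u : clique_space K M 0) :
  exists c, u = c *: << clique_unit M >>.
Proof.
exists u@_(clique_unit M); apply/malgP => p.
by rewrite mcoeffZ (clique0_unique p) mcoeffUU mulr1.
Qed.

(** Stated with [u@_p != 0 -> H] rather than its contrapositive, so that
    membership in [H] is obtained without excluded middle. *)
Definition prime_terms_in (H : op_subset (clique_operad K M)) :
    op_subset (clique_operad K M) :=
  fun k (u : clique_space K M k) =>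
    forall p, prime_clique p -> u@_p != 0 -> H k << p >>.

(** Closure under composition: with two factors of arity at least 2 there are no
    prime terms, and a factor of arity 1 is a scalar multiple of the unit, so
    that composing with it only rescales the other factor. *)
Lemma prime_terms_suboperad (H : op_subset (clique_operad K M)) :
  suboperad (prime_terms_in H).
Proof.
have zeroS k : prime_terms_in H (0 : clique_space K M k).
  by move=> p _; rewrite mcoeff0 eqxx.
have linS k c (u v : clique_space K M k) :
    prime_terms_in H u -> prime_terms_in H v -> prime_terms_in H (c *: u + v).
  move=> uS vS p pp; rewrite mcoeffD mcoeffZ.
  have [u0|un0 _] := eqVneq u@_p 0; last exact: uS.
  by rewrite u0 mulr0 add0r; apply: vS.
have scaleS k c (u : clique_space K M k) :
    prime_terms_in H u -> prime_terms_in H (c *: u).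
  by move=> uS; rewrite -[c *: u]addr0; apply: linS.
split=> // n m i u v uS vS.
case: n i u uS => [|n] i u uS.
  have [c ->] := clique_space0 u; rewrite (ord1 i) /=.
  rewrite (GRing.scalable_linear (clique_op_comp_linear_l _ _)).
  by rewrite clique_op_unit_l; apply: scaleS.
case: m v vS => [|m] v vS; last first.
  by move=> p pp; rewrite /= mcoeff_comp_prime // eqxx.
have [c ->] := clique_space0 v.
rewrite /= (GRing.scalable_linear (clique_op_comp_linear_r _ _)).
apply: scaleS; apply/(op_subset_cast (prime_terms_in H) (addn0 n.+1)).
by rewrite /= clique_op_unit_r.
Qed.

End Generation.

Theorem proposition2p2p3 (K : fieldType) (char0 : [pchar K]%R =i pred0)
  (M : umagmaType) :
  minimal_generating (O := clique_operad K M) (prime_cliques K M).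
Proof.
split; first exact: prime_cliques_generate.
move=> H HP Hgen k _ [p pp ->].
have HS : op_incl H (prime_terms_in H).
  move=> l u Hu q qp; have [r _ uE] := HP _ _ Hu.
  rewrite uE mcoeffU; case: (r =P q) => [<- _|_]; last by rewrite eqxx.
  by rewrite -uE.
have := Hgen k << p >> _ (prime_terms_suboperad H) HS p pp.
by apply; rewrite mcoeffUU oner_eq0.
Qed.
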